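(* Let $(R,\mathfrak m)$ be a Cohen-Macaulay local ring of dimension two with infinite residue field, let $I,J$ be $\mathfrak m$-primary ideals of $R$, and let $(a,b)$ be a joint reduction of $I$ and $J$. Let $r_0,s_0\ge0$ be integers. Suppose that any one of the following (equivalent) conditions holds: (a) for all $k\gg0$, $I^{r_0+k}J^{s_0+k}=a^kI^{r_0}J^{s_0+k}+b^kI^{r_0+k}J^{s_0}$; (b) $e_{(0,1)}=g_1(r_0)+r_0e_{(1,1)}$, $e_{(1,0)}=h_1(s_0)+s_0e_{(1,1)}$ and $$e_2(IJ)=g_2(r_0)+h_2(s_0)-\ell(R/I^{r_0}J^{s_0})+r_0s_0e_{(1,1)}+\ell\left(\frac{\widetilde{\mathcal F}_{(a,b)}(I^{r_0},J^{s_0})}{I^{r_0}J^{s_0}}\right);$$ (c) $M^1_{r_0,s_0}(a^k,b^k)=0$ for all $k\gg0$. Then $(r_0,s_0)\in\Lambda(I^k|J^k)$ for all $k\gg0$.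
   Context: $\ell$ denotes length of $R$-modules, and $I^0=J^0=R$. A pair $(a,b)$ is a joint reduction of $I$ and $J$ if $a\in I$, $b\in J$ and $I^{r+1}J^{s+1}=aI^rJ^{s+1}+bI^{r+1}J^s$ for all large $r,s$. The joint reduction lattice is $\Lambda(I|J):=\{(r,s)\in\mathbb N^2: I^{r+1}J^{s+1}=aI^rJ^{s+1}+bI^{r+1}J^s\text{ for some joint reduction }(a,b)\text{ of }I\text{ and }J\}$ (with $0\in\mathbb N$). For $r,s\ge 0$, $k\ge1$: $M^1_{r,s}(a^k,b^k):=\dfrac{I^{r+k}J^{s+k}}{a^kI^rJ^{s+k}+b^kI^{r+k}J^s}$, and $\widetilde{\mathcal F}_{(a,b)}(I^r,J^s):=\bigcup_{k\ge1}\big((I^{r+k}J^s:a^k)\cap(I^rJ^{s+k}:b^k)\big)$. Hilbert coefficients: for an $\mathfrak m$-primary ideal $K$, $\ell(R/K^n)=e_0(K)\binom{n+1}{2}-e_1(K)n+e_2(K)$ for $n\gg0$. Bigraded Hilbert coefficients $e_{(i,j)}$ of $\{I^rJ^s\}$: $\ell(R/I^rJ^s)=\sum_{i+j\le 2}(-1)^{i+j}e_{(i,j)}\binom{r+i-1}{i}\binom{s+j-1}{j}$ for all $r,s\gg0$. For each fixed $r\ge0$ there are integers $g_1(r),g_2(r)$ with $\ell(R/I^rJ^s)=e_0(J)\binom{s+1}{2}-g_1(r)s+g_2(r)$ for all $s\gg0$; for each fixed $s\ge0$ there are integers $h_1(s),h_2(s)$ with $\ell(R/I^rJ^s)=e_0(I)\binom{r+1}{2}-h_1(s)r+h_2(s)$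 for all $r\gg0$. *)

(* Defs.v *)
(* Classical sets of MathComp-Analysis are used on top of MathComp: subsets of
   a ring (ideals, primes, colon ideals) are Prop-valued. *)
From HB Require Import structures.
From mathcomp Require Import all_boot all_algebra.
From mathcomp Require Import boolp classical_sets cardinality.

Set Implicit Arguments.
Unset Strict Implicit.
Unset Printing Implicit Defensive.

Import GRing.Theory.
Local Open Scope classical_set_scope.
Local Open Scope ring_scope.
Local Open Scope quotient_scope.

Section Ideals.
Variable R : comNzRingType.

Definition is_ideal (S : set R) : Prop :=
  [/\ S 0, (forall x y, S x -> S y -> S (x + y))
    & (forall a x, S x -> S (a * x))].

(* The unit ideal is allowed, as I ^+ 0 must be an ideal. *)
Record ideal := Ideal { ideal_set :> set R; idealP : is_ideal ideal_set }.

HB.instance Definition _ := gen_eqMixin ideal.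
HB.instance Definition _ := gen_choiceMixin ideal.

Lemma ideal0 (I : ideal) : ideal_set I 0. Proof. by case: (idealP I). Qed.

Lemma idealD (I : ideal) x y : ideal_set I x -> ideal_set I y -> ideal_set I (x + y).
Proof. by case: (idealP I) => _ + _; apply. Qed.

Lemma idealM (I : ideal) a x : ideal_set I x -> ideal_set I (a * x).
Proof. by case: (idealP I) => _ _; apply. Qed.

Lemma idealN (I : ideal) x : ideal_set I x -> ideal_set I (- x).
Proof. by rewrite -mulN1r; exact: idealM. Qed.

Lemma ideal_inj (I J : ideal) : I = J :> set R -> I = J.
Proof.
case: I J => [I hI] [J hJ] /= eIJ; subst J.
by congr Ideal; exact: Prop_irrelevance.
Qed.

Lemma ideal_eq (I J : ideal) : I `<=` J -> J `<=` I -> I = J.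
Proof. by move=> h1 h2; apply: ideal_inj; apply/seteqP. Qed.

Lemma is_ideal_smallest (S : set R) : is_ideal (smallest is_ideal S).
Proof.
split=> [M [[M0 _ _] _] //|x y Sx Sy M hM|a x Sx M hM].
- by case: (hM) => -[_ MD _] _; apply: MD; [exact: Sx | exact: Sy].
- by case: (hM) => -[_ _ MM] _; apply: MM; exact: Sx.
Qed.

Definition ideal_gen (S : set R) : ideal := Ideal (is_ideal_smallest S).

Lemma sub_ideal_gen (S : set R) : S `<=` ideal_gen S.
Proof. exact: sub_gen_smallest. Qed.

Lemma ideal_gen_sub (S : set R) (K : ideal) : S `<=` K -> ideal_gen S `<=` K.
Proof. by apply: smallest_sub; exact: idealP. Qed.

Lemma is_ideal_colon (I : ideal) (x : R) : is_ideal [set y | ideal_set I (x * y)].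
Proof.
split=> [|y z Iy Iz|a y Iy] /=; first by rewrite mulr0; exact: ideal0.
- by rewrite mulrDr; exact: idealD.
- by rewrite mulrCA; exact: idealM.
Qed.

Definition colon (I : ideal) (x : R) : ideal := Ideal (is_ideal_colon I x).

Lemma colonE (I : ideal) (x y : R) :
  ideal_set (colon I x) y = ideal_set I (x * y).
Proof. by []. Qed.

Definition ideal_add (I J : ideal) : ideal := ideal_gen (I `|` J).

Definition ideal_mul (I J : ideal) : ideal :=
  ideal_gen [set x * y | x in I & y in J].

Lemma is_ideal_set0 : is_ideal [set 0].
Proof.
by split=> [|x y -> ->|a x ->] //=; rewrite ?addr0 ?mulr0.
Qed.

Lemma is_ideal_setT : is_ideal [set: R]. Proof. by []. Qed.

Lemma ideal_add_sub (I J K : ideal) :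
  ideal_add I J `<=` K <-> I `<=` K /\ J `<=` K.
Proof.
rewrite -subUset; split=> [h|]; last exact: ideal_gen_sub.
exact: subset_trans (@sub_ideal_gen _) h.
Qed.

Lemma ideal_mul_sub (I J K : ideal) :
  ideal_mul I J `<=` K <->
    (forall x y, ideal_set I x -> ideal_set J y -> ideal_set K (x * y)).
Proof.
split=> [h x y Ix Jy|h]; first by apply: (h); apply: sub_ideal_gen; exists x => //; exists y.
by apply: ideal_gen_sub => _ [x Ix [y Jy <-]]; exact: h.
Qed.

Lemma mem_ideal_mul (I J : ideal) x y :
  ideal_set I x -> ideal_set J y -> ideal_set (ideal_mul I J) (x * y).
Proof. by move: x y; apply/ideal_mul_sub. Qed.

Lemma mem_ideal_addl (I J : ideal) : I `<=` ideal_add I J.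
Proof. by have /ideal_add_sub[] : ideal_add I J `<=` ideal_add I J by []. Qed.

Lemma mem_ideal_addr (I J : ideal) : J `<=` ideal_add I J.
Proof. by have /ideal_add_sub[] : ideal_add I J `<=` ideal_add I J by []. Qed.

Lemma ideal_addC : commutative ideal_add.
Proof. by move=> I J; apply: ideal_inj; rewrite /= setUC. Qed.

Lemma ideal_addA : associative ideal_add.
Proof.
move=> I J K; apply: ideal_eq; apply/ideal_add_sub; split.
- by move=> x Ix; do 2!apply: mem_ideal_addl.
- apply/ideal_add_sub; split=> x; last exact: mem_ideal_addr.
  by move=> Jx; apply: mem_ideal_addl; apply: mem_ideal_addr.
- apply/ideal_add_sub; split=> x; first exact: mem_ideal_addl.
  by move=> Jx; apply: mem_ideal_addr; apply: mem_ideal_addl.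
- by move=> x Kx; do 2!apply: mem_ideal_addr.
Qed.

Lemma ideal_add0 : left_id (Ideal is_ideal_set0) ideal_add.
Proof.
move=> I; apply: ideal_eq; last exact: mem_ideal_addr.
by apply/ideal_add_sub; split=> // x ->; exact: ideal0.
Qed.

HB.instance Definition _ :=
  GRing.isNmodule.Build ideal ideal_addA ideal_addC ideal_add0.

Lemma ideal_mulC : commutative ideal_mul.
Proof.
by move=> I J; apply: ideal_eq; apply/ideal_mul_sub => x y ? ?;
  rewrite mulrC; apply: mem_ideal_mul.
Qed.

Lemma ideal_mulA : associative ideal_mul.
Proof.
have sub I J K : ideal_mul I (ideal_mul J K) `<=` ideal_mul (ideal_mul I J) K.
  apply/ideal_mul_sub => x z Ix; move: z.
  suff : ideal_mul J K `<=` colon (ideal_mul (ideal_mul I J) K) x by [].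
  apply/ideal_mul_sub => y z Jy Kz; rewrite colonE mulrA.
  by do 2?apply: mem_ideal_mul.
move=> I J K; apply: ideal_eq; first exact: sub.
rewrite (ideal_mulC (ideal_mul I J)) (ideal_mulC I J).
by rewrite (ideal_mulC I (ideal_mul J K)) (ideal_mulC J K); apply: sub.
Qed.

Lemma ideal_mul1 : left_id (Ideal is_ideal_setT) ideal_mul.
Proof.
move=> I; apply: ideal_eq; last by move=> x Ix; rewrite -[x]mul1r; apply: mem_ideal_mul.
by apply/ideal_mul_sub => x y _; exact: idealM.
Qed.

Lemma ideal_mulDl : left_distributive ideal_mul +%R.
Proof.
move=> I J K; apply: ideal_eq; last first.
  apply/ideal_add_sub; split; apply/ideal_mul_sub => x y ? ?;
    apply: mem_ideal_mul => //; [exact: mem_ideal_addl|exact: mem_ideal_addr].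
apply/ideal_mul_sub => x y + Ky; move: x.
suff : (I + J : ideal) `<=` colon (ideal_mul I K + ideal_mul J K : ideal) y.
  by move=> h x /h; rewrite colonE mulrC.
apply/ideal_add_sub; split=> x ?; rewrite colonE mulrC.
  by apply: mem_ideal_addl; apply: mem_ideal_mul.
by apply: mem_ideal_addr; apply: mem_ideal_mul.
Qed.

Lemma ideal_mul0 : left_zero (0 : ideal) ideal_mul.
Proof.
move=> I; apply: ideal_eq; last by move=> x ->; exact: ideal0.
by apply/ideal_mul_sub => x y -> _; rewrite mul0r.
Qed.

(* Ideals form a commutative semiring, whence the notations I + J, I * J and
   I ^+ n, with I ^+ 0 = 1 the unit ideal. *)
HB.instance Definition _ := GRing.Nmodule_isComPzSemiRing.Build ideal
  ideal_mulA ideal_mulC ideal_mul1 ideal_mulDl ideal_mul0.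

(* princ a * I is the ideal aI. *)
Definition princ (a : R) : ideal := ideal_gen [set a].

Definition ideal_pred (I : ideal) : {pred R} := fun x => `[< ideal_set I x >].

Lemma ideal_pred_zmod (I : ideal) : zmod_closed (ideal_pred I).
Proof.
split=> [|x y /asboolP Ix /asboolP Iy]; apply/asboolP; first exact: ideal0.
by apply: idealD => //; exact: idealN.
Qed.

HB.instance Definition _ (I : ideal) :=
  GRing.isZmodClosed.Build R (ideal_pred I) (ideal_pred_zmod I).

Definition quot (I : ideal) : Type := {ideal_quot (ideal_pred I)}.
HB.instance Definition _ (I : ideal) := GRing.Zmodule.on (quot I).
HB.instance Definition _ (I : ideal) :=
  EqQuotient.on (quot I).

Section QuotientModule.
Variable I : ideal.

Lemma quot_eqP (x y : R) :
  reflect (ideal_set I (x - y)) (\pi_(quot I) x == \pi_(quot I) y).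
Proof.
have -> : (\pi_(quot I) x == \pi_(quot I) y) = (x - y \in ideal_pred I).
  by rewrite (Quotient.idealrBE (ideal_pred I)).
exact: asboolP.
Qed.

Definition quot_scale (a : R) (x : quot I) : quot I := \pi_(quot I) (a * repr x).

Lemma quot_scale_pi a x : quot_scale a (\pi_(quot I) x) = \pi_(quot I) (a * x).
Proof.
apply/eqP/quot_eqP; rewrite -mulrBr; apply/idealM/quot_eqP.
by rewrite reprK.
Qed.

Lemma quot_piD (x y : R) : \pi_(quot I) (x + y) = \pi_(quot I) x + \pi_(quot I) y.
Proof.
by rewrite (raddfD (\pi_{ideal_quot (ideal_pred I)} : R -> _)).
Qed.

Lemma quot_scaleA a b x : quot_scale a (quot_scale b x) = quot_scale (a * b) x.
Proof. by elim/quotW: x => x; rewrite (quot_scale_pi b) !quot_scale_pi mulrA. Qed.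

Lemma quot_scale1 : left_id 1 quot_scale.
Proof. by elim/quotW=> x; rewrite quot_scale_pi mul1r. Qed.

Lemma quot_scaleDr : right_distributive quot_scale +%R.
Proof.
move=> a; elim/quotW=> x; elim/quotW=> y; rewrite -quot_piD !quot_scale_pi.
by rewrite mulrDr quot_piD.
Qed.

Lemma quot_scaleDl x : {morph quot_scale^~ x : a b / a + b}.
Proof.
by elim/quotW: x => x a b; rewrite !quot_scale_pi mulrDl quot_piD.
Qed.

HB.instance Definition _ := GRing.Zmodule_isLmodule.Build R (quot I)
  quot_scaleA quot_scale1 quot_scaleDr quot_scaleDl.
End QuotientModule.

(* A / B as an R-submodule of R / B, for ideals B <= A: the set of the cosets
   x + B with x in A. *)
Definition subquot (A : set R) (B : ideal) : set (quot B) :=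
  [set \pi_(quot B) x | x in A].

End Ideals.

Arguments subquot {R} A B.

Section Chains.
Variable T : Type.

Definition strict_chain (P : set (set T)) (n : nat) (c : nat -> set T) : Prop :=
  (forall i, (i <= n)%N -> P (c i)) /\
  (forall i, (i < n)%N -> c i `<` c i.+1).

Definition sup_chain_length (P : set (set T)) (n : nat) : Prop :=
  (exists c, strict_chain P n c) /\
  (forall k c, strict_chain P k c -> (k <= n)%N).

End Chains.

Section Length.
Variables (R : comNzRingType) (V : lmodType R).

(* The length of a submodule N of V: the largest n such that there is a chain
   N_0 < ... < N_n of submodules of N. It is 0 by convention if N has infinite
   length. *)
Definition module_length (N : set V) : nat :=
  xget 0%N (sup_chain_length
              [set L : set V | GRing.submod_closed (mem L) /\ L `<=` N]).

End Length.

Definition len (R : comNzRingType) (A : set R) (B : ideal R) : nat :=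
  module_length (subquot A B).

Section LocalRings.
Variable R : comNzRingType.

Definition noetherian : Prop :=
  forall I : ideal R, exists s : seq R, I = ideal_gen [set` s].

Definition maximal_ideal (m : ideal R) : Prop :=
  m <> 1 /\ forall I : ideal R, m `<=` I -> I = m \/ I = 1.

Definition local_ring (m : ideal R) : Prop :=
  maximal_ideal m /\ forall m' : ideal R, maximal_ideal m' -> m' = m.

Definition prime_ideal (P : set R) : Prop :=
  [/\ is_ideal P, ~ P 1 & forall x y, P (x * y) -> P x \/ P y].

Definition krull_dim (d : nat) : Prop := sup_chain_length prime_ideal d.

Definition regular_sequence (s : seq R) : Prop :=
  (forall i, (i < size s)%N ->
     injective (fun x : quot (ideal_gen [set` take i s]) => s`_i *: x)) /\
  ideal_gen [set` s] <> 1.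

Definition depth (m : ideal R) (d : nat) : Prop :=
  (exists s, [/\ regular_sequence s, [set` s] `<=` m & size s = d]) /\
  (forall s, regular_sequence s -> [set` s] `<=` m -> (size s <= d)%N).

Definition cohen_macaulay_local (m : ideal R) : Prop :=
  [/\ noetherian, local_ring m & exists d, krull_dim d /\ depth m d].

Definition radical (I : set R) : set R := [set x | exists n, I (x ^+ n)].

Definition primary_to (m Q : ideal R) : Prop :=
  [/\ ~ ideal_set Q 1,
      (forall x y, ideal_set Q (x * y) -> ideal_set Q x \/ radical Q y)
    & radical Q = m].

End LocalRings.

Definition for_large (P : nat -> Prop) : Prop :=
  exists N, forall n, (N <= n)%N -> P n.

Definition for_large2 (P : nat -> nat -> Prop) : Prop :=
  exists N, forall r s, (N <= r)%N -> (N <= s)%N -> P r s.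

Section JointReductions.
Variable R : comNzRingType.
Implicit Types (I J K : ideal R) (a b : R) (r s k : nat).

Definition reduction_eq I J a b r s : Prop :=
  I ^+ r.+1 * J ^+ s.+1 =
  princ a * I ^+ r * J ^+ s.+1 + princ b * I ^+ r.+1 * J ^+ s.

Definition joint_reduction I J a b : Prop :=
  [/\ ideal_set I a, ideal_set J b & for_large2 (reduction_eq I J a b)].

Definition joint_reduction_lattice I J : set (nat * nat) :=
  [set rs | exists a b,
     joint_reduction I J a b /\ reduction_eq I J a b rs.1 rs.2].

Definition M1_num I J r s k : ideal R := I ^+ (r + k) * J ^+ (s + k).

Definition M1_den I J a b r s k : ideal R :=
  princ (a ^+ k) * I ^+ r * J ^+ (s + k) +
  princ (b ^+ k) * I ^+ (r + k) * J ^+ s.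

Definition M1 I J a b r s k : set (quot (M1_den I J a b r s k)) :=
  subquot (M1_num I J r s k) (M1_den I J a b r s k).
Arguments M1 : clear implicits.

Definition Ftilde I J a b r s : set R :=
  \bigcup_(k in [set k | (1 <= k)%N])
    (colon (I ^+ (r + k) * J ^+ s) (a ^+ k) `&`
     colon (I ^+ r * J ^+ (s + k)) (b ^+ k)).

Definition bilen I J r s : int := (len [set: R] (I ^+ r * J ^+ s))%:Z.

Definition hilbert_coeffs K (e : nat -> int) : Prop :=
  for_large (fun n => (len [set: R] (K ^+ n))%:Z =
    e 0%N * 'C(n + 1, 2)%:Z - e 1%N * n%:Z + e 2%N).

(* The truncated subtractions are harmless: only large r, s matter, and r + i - 1
   is truncated only when r = i = 0. *)
Definition bigraded_hilbert_coeffs I J (e : nat -> nat -> int) : Prop :=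
  for_large2 (fun r s => bilen I J r s =
    \sum_(i < 3) \sum_(j < 3 | (i + j <= 2)%N)
      (-1) ^+ (i + j) * e i j * 'C(r + i - 1, i)%:Z * 'C(s + j - 1, j)%:Z).

Definition row_hilbert_coeffs I J (e0J : int) (g1 g2 : nat -> int) : Prop :=
  forall r, for_large (fun s => bilen I J r s =
    e0J * 'C(s + 1, 2)%:Z - g1 r * s%:Z + g2 r).

Definition col_hilbert_coeffs I J (e0I : int) (h1 h2 : nat -> int) : Prop :=
  forall s, for_large (fun r => bilen I J r s =
    e0I * 'C(r + 1, 2)%:Z - h1 s * r%:Z + h2 s).

Definition condition_a I J a b r0 s0 : Prop :=
  for_large (fun k => I ^+ (r0 + k) * J ^+ (s0 + k) =
    princ (a ^+ k) * I ^+ r0 * J ^+ (s0 + k) +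
    princ (b ^+ k) * I ^+ (r0 + k) * J ^+ s0).

(* The coefficients occurring here (e i j only matters for i + j <= 2) are
   uniquely determined by the asymptotic formulas defining them, so the
   existential quantifiers only name them. *)
Definition condition_b I J a b r0 s0 : Prop :=
  exists (eI eJ eIJ : nat -> int) (e : nat -> nat -> int)
         (g1 g2 h1 h2 : nat -> int),
  [/\ hilbert_coeffs I eI, hilbert_coeffs J eJ & hilbert_coeffs (I * J) eIJ] /\
  [/\ bigraded_hilbert_coeffs I J e, row_hilbert_coeffs I J (eJ 0%N) g1 g2
    & col_hilbert_coeffs I J (eI 0%N) h1 h2] /\
  [/\ e 0%N 1%N = g1 r0 + r0%:Z * e 1%N 1%N,
      e 1%N 0%N = h1 s0 + s0%:Z * e 1%N 1%N
    & eIJ 2%N = g2 r0 + h2 s0 - bilen I J r0 s0 + r0%:Z * s0%:Z * e 1%N 1%N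
                + (len (Ftilde I J a b r0 s0) (I ^+ r0 * J ^+ s0))%:Z].

Definition condition_c I J a b r0 s0 : Prop :=
  for_large (fun k => M1 I J a b r0 s0 k = [set 0]).

End JointReductions.

Arguments M1 {R} I J a b r s k.

(* Main.v *)
(* Conditions (a) and (c) say the same thing, and multiplying the equality in (a)
   by [I^((k-1)r0) J^((k-1)s0)] shows that [(a^k, b^k)] is a joint reduction of
   [I^k] and [J^k] whose defining equality already holds at [(r0, s0)].

   For (b), depth 2 forces [a^k, b^k] to have only trivial syzygies, so a Koszul
   sequence on [R/I^r J^(s+k)] and [R/I^(r+k) J^s] expresses the mixed second
   difference of [l(R/I^r J^s)] as
     l(R/(a^k, b^k)) - l(M^1_{r,s}(a^k, b^k)) + l(F_k / I^r J^s),
   where [F_k] is the [k]-th term of the union defining [Ftilde]. For large [r, s]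
   the term [M^1] vanishes and the difference is [k^2 e_(1,1)], whence
   [l(R/(a^k, b^k)) <= k^2 e_(1,1)]. At [(r0, s0)] and for large [k] the
   equalities in (b) make the difference equal to
   [k^2 e_(1,1) + l(Ftilde / I^r0 J^s0)], so that [l(M^1) <= 0]. *)
Require Import Defs.
From mathcomp Require Import all_boot all_algebra.
From mathcomp Require Import boolp classical_sets cardinality.
From mathcomp Require Import zify ring lra.

Set Implicit Arguments.
Unset Strict Implicit.
Unset Printing Implicit Defensive.

Import GRing.Theory.
Local Open Scope classical_set_scope.
Local Open Scope ring_scope.
Local Open Scope quotient_scope.

(** * Sums, products and principal multiples of ideals *)

Section IdealArithmetic.
Variable R : comNzRingType.
Implicit Types (I J K L A B C : ideal R) (x y : R).

Lemma mem_ideal_add I J x :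
  ideal_set (I + J) x <->
  exists y z, [/\ ideal_set I y, ideal_set J z & x = y + z].
Proof.
split=> [|[y [z [Iy Jz ->]]]]; last first.
  by apply: idealD; [exact: mem_ideal_addl|exact: mem_ideal_addr].
have S : is_ideal [set x | exists y z,
    [/\ ideal_set I y, ideal_set J z & x = y + z]].
  split=> [|_ _ [y [z [Iy Jz ->]]] [y' [z' [Iy' Jz' ->]]]|c _ [y [z [Iy Jz ->]]]].
  - by exists 0, 0; split; [exact: ideal0|exact: ideal0|by rewrite addr0].
  - exists (y + y'), (z + z'); split.
    + exact: idealD.
    + exact: idealD.
    + by rewrite addrACA.
  - by exists (c * y), (c * z); split; [exact: idealM|exact: idealM|by rewrite mulrDr].
apply: (@ideal_add_sub _ I J (Ideal S)).2; split=> u Iu.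
- by exists u, 0; split; [done|exact: ideal0|by rewrite addr0].
- by exists 0, u; split; [exact: ideal0|done|by rewrite add0r].
Qed.

Lemma mem_princ_mul x A y :
  ideal_set (princ x * A) y <-> exists2 t, ideal_set A t & y = x * t.
Proof.
split=> [|[t At ->]]; last first.
  by apply: mem_ideal_mul => //; exact: sub_ideal_gen.
have S : is_ideal [set y | exists2 t, ideal_set A t & y = x * t].
  split=> [|_ _ [t At ->] [u Au ->]|c _ [t At ->]].
  - by exists 0; [exact: ideal0|by rewrite mulr0].
  - by exists (t + u); [exact: idealD|by rewrite mulrDr].
  - by exists (c * t); [exact: idealM|by rewrite mulrCA].
move: y; apply: (@ideal_mul_sub _ (princ x) A (Ideal S)).2 => y z py Az.
(* Membership in a colon ideal need only be checked on the generator [x]. *)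
have : princ x `<=` colon (Ideal S) z.
  by apply: ideal_gen_sub => _ ->; exists z => //; rewrite mulrC.
by move=> /(_ _ py); rewrite colonE mulrC.
Qed.

Lemma mem_princ x y : ideal_set (princ x) y <-> exists t, y = x * t.
Proof.
rewrite -[princ x]mulr1; split=> [/mem_princ_mul[t _ ->]|[t ->]].
  by exists t.
by apply/mem_princ_mul; exists t.
Qed.

Lemma mem_princ_mul_add x A B y :
  ideal_set (princ x * A + B) y <->
  exists t z, [/\ ideal_set A t, ideal_set B z & y = x * t + z].
Proof.
split=> [/mem_ideal_add[u [z [/mem_princ_mul[t At ->] Bz ->]]]|].
  by exists t, z.
move=> [t [z [At Bz ->]]]; apply/mem_ideal_add; exists (x * t), z; split=> //.
by apply/mem_princ_mul; exists t.
Qed.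

Lemma ideal_addS I I' J J' :
  I `<=` I' -> J `<=` J' -> (I + J : ideal R) `<=` (I' + J' : ideal R).
Proof.
move=> hI hJ; apply/ideal_add_sub; split=> x.
  by move/hI; exact: mem_ideal_addl.
by move/hJ; exact: mem_ideal_addr.
Qed.

Lemma ideal_mulS I I' J J' :
  I `<=` I' -> J `<=` J' -> (I * J : ideal R) `<=` (I' * J' : ideal R).
Proof.
by move=> hI hJ; apply/ideal_mul_sub => x y /hI ? /hJ ?; exact: mem_ideal_mul.
Qed.

Lemma mem_idealX I x n : ideal_set I x -> ideal_set (I ^+ n) (x ^+ n).
Proof.
move=> Ix; elim: n => [|n IHn]; first by rewrite !expr0.
by rewrite !exprS; exact: mem_ideal_mul.
Qed.

Lemma princ_subX I x n : ideal_set I x -> princ (x ^+ n) `<=` (I ^+ n : ideal R).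
Proof. by move=> Ix; apply: ideal_gen_sub => _ ->; exact: mem_idealX. Qed.

Lemma princM x y : princ x * princ y = princ (x * y).
Proof.
apply: ideal_eq => z.
  move=> /mem_princ_mul[t /mem_princ[u ->] ->]; apply/mem_princ.
  by exists u; rewrite mulrA.
move=> /mem_princ[t ->]; rewrite -mulrA; apply/mem_princ_mul.
by exists (y * t) => //; apply/mem_princ; exists t.
Qed.

Lemma princ1 : princ (1 : R) = 1.
Proof. by apply: ideal_eq => // z _; apply/mem_princ; exists z; rewrite mul1r. Qed.

Definition ideal_cap A B : ideal R.
Proof.
exists (ideal_set A `&` ideal_set B); split=> [|x y [Ax Bx] [Ay By]|c x [Ax Bx]].
- by split; exact: ideal0.
- by split; exact: idealD.
- by split; exact: idealM.
Defined.

End IdealArithmetic.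

Lemma quot_pi0 (R : comNzRingType) (B : ideal R) : \pi_(quot B) 0 = 0.
Proof. exact: (raddf0 (\pi_{ideal_quot (ideal_pred B)} : R -> _)). Qed.

(** * Lengths of quotients of ideals *)

Section IdealChains.
Variable R : comNzRingType.
Implicit Types (I J K L M A B C E : ideal R) (x y : R).

(** The chain ends exactly at [A], but its lowest term only has to contain [B]. This makes the
    predicate monotone in both ends and lets chains be shortened or glued freely. *)
Fixpoint ideal_chain (n : nat) B A : Prop :=
  if n is n'.+1 then exists L, ideal_chain n' B L /\ L `<` A else B `<=` A.

Lemma ideal_chainW n B B' A A' :
  B' `<=` B -> A `<=` A' -> ideal_chain n B A -> ideal_chain n B' A'.
Proof.
move=> hB; elim: n A A' => [|n IHn] A A' hA /=.
  by move=> h; apply: subset_trans hA; exact: subset_trans h.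
move=> [L [hL [LA AL]]]; exists L; split; first exact: IHn hL.
by split; [exact: subset_trans hA|move=> h; apply: AL; exact: subset_trans h].
Qed.

Lemma ideal_chain_sub n B A : ideal_chain n B A -> B `<=` A.
Proof.
elim: n A => [//|n IHn] A [L [/IHn BL [LA _]]]; exact: subset_trans LA.
Qed.

Lemma ideal_chain_cat p q C B A :
  ideal_chain p C B -> ideal_chain q B A -> ideal_chain (p + q) C A.
Proof.
move=> hp; elim: q A => [|q IHq] A.
  by rewrite addn0 => BA; exact: ideal_chainW hp.
by rewrite addnS => -[L [hL LA]]; exists L; split => //; exact: IHq.
Qed.

(* By the modular law, each step [L < A] of a chain is strict after
   intersecting with [B] or after adding [B]. *)
Lemma ideal_chain_split n C B A : C `<=` B -> ideal_chain n C A ->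
  exists p q, [/\ n = (p + q)%N, ideal_chain p C (ideal_cap A B)
                & ideal_chain q B (A + B)].
Proof.
move=> CB; elim: n A => [|n IHn] A /=.
  move=> CA; exists 0%N, 0%N; split=> //= x; last exact: mem_ideal_addr.
  by move=> Cx; split; [exact: CA|exact: CB].
move=> [L [/IHn[p [q [-> hp hq]]] [LA AL]]].
have capS : ideal_cap L B `<=` ideal_cap A B by move=> x [/LA].
have addS : (L + B : ideal R) `<=` (A + B : ideal R) by exact: ideal_addS.
have [capL|ncapL] := pselect (ideal_cap A B `<=` ideal_cap L B); last first.
  exists p.+1, q; split=> //; first by exists (ideal_cap L B).
  exact: ideal_chainW hq.
exists p, q.+1; split; [by rewrite addnS|exact: ideal_chainW hp|].
exists (L + B); split=> //; split=> // addL; apply: AL => x Ax.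
have /addL/mem_ideal_add[y [z [Ly Bz xE]]] : ideal_set (A + B) x.
  exact: mem_ideal_addl.
suff [Lz _] : ideal_set (ideal_cap L B) z by rewrite xE; exact: idealD.
apply: capL; split=> //; have -> : z = x - y by rewrite xE addrC addKr.
by apply: idealD => //; apply: idealN; exact: LA.
Qed.

Definition is_length A B n :=
  ideal_chain n B A /\ forall k, ideal_chain k B A -> (k <= n)%N.

(** Since [len] is 0 by convention on infinite length, this bound has to accompany the length
    computations below. *)
Definition finite_length A B :=
  exists n, forall k, ideal_chain k B A -> (k <= n)%N.

Lemma finite_lengthP A B :
  B `<=` A -> finite_length A B -> exists n, is_length A B n.
Proof.
move=> BA [n hn].
have ex : exists k, `[< ideal_chain k B A >] by exists 0%N; apply/asboolP.
have bd k : `[< ideal_chain k B A >] -> (k <= n)%N by move/asboolP; exact: hn.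
case: (ex_maxnP ex bd) => i /asboolP hi mi; exists i; split=> // k hk.
by apply: mi; exact/asboolP.
Qed.

Lemma finite_lengthS A B A' B' :
  A' `<=` A -> B `<=` B' -> finite_length A B -> finite_length A' B'.
Proof. by move=> hA hB [n hn]; exists n => k /(ideal_chainW hB hA); exact: hn. Qed.

Lemma finite_length_trans A B C : C `<=` B -> B `<=` A ->
  finite_length A B -> finite_length B C -> finite_length A C.
Proof.
move=> CB BA [n hn] [p hp]; exists (p + n)%N => k.
move=> /(ideal_chain_split CB)[i [j [-> hi hj]]].
apply: leq_add; [apply: hp|apply: hn].
  by apply: ideal_chainW hi => // x [].
by apply: ideal_chainW hj => //; apply/ideal_add_sub; split.
Qed.

(** The lattice correspondence for [A / B]: a chain of submodules is pulled back along the
    projection, a chain of ideals is pushed forward. It links [len] to chains of ideals. *)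
Lemma subquotP A B : B `<=` A -> forall n,
  (exists c, strict_chain [set L : set (quot B) |
      GRing.submod_closed (mem L) /\ L `<=` subquot A B] n c) <->
  ideal_chain n B A.
Proof.
move=> BA n; split=> [[c [cP cS]]|].
- have K_ideal i : (i <= n)%N -> is_ideal [set x | c i (\pi_(quot B) x)].
    move=> /cP[[c0 cD] _]; have c0' : c i 0 by move: c0; rewrite in_setE.
    have {}cD k u v : c i u -> c i v -> c i (quot_scale k u + v).
      by move=> cu cv; have := cD k u v; rewrite !in_setE; exact.
    split=> [|x y cx cy|k x cx] /=; first by rewrite quot_pi0.
      by have := cD 1 _ _ cx cy; rewrite quot_scale1 -quot_piD.
    by have := cD k _ _ cx c0'; rewrite addr0 quot_scale_pi.
  have step i : (i <= n)%N -> exists K : ideal R,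
      ideal_set K = [set x | c i (\pi_(quot B) x)] /\ ideal_chain i B K.
    elim: i => [|i IHi] ile.
      exists (Ideal (K_ideal _ ile)); split=> //= x Bx /=.
      suff -> : \pi_(quot B) x = \pi_(quot B) 0 by have [] := K_ideal 0%N isT.
      by apply/eqP/quot_eqP; rewrite subr0.
    have [K [KE Kc]] := IHi (ltnW ile).
    exists (Ideal (K_ideal _ ile)); split=> //; exists K; split=> //.
    have [s ns] := cS i ile; rewrite KE; split=> [x /=|h]; first exact: s.
    by apply: ns => u; rewrite -[u]reprK; exact: h.
  (* The top preimage lies in [A]: its elements are congruent modulo [B] to elements of [A], and [B]
     is contained in [A]. *)
  have [K [KE]] := step n (leqnn n); apply: ideal_chainW => // x.
  rewrite KE => /= cx; have [_ /(_ _ cx)[y Ay /eqP/quot_eqP Bxy]] := cP n (leqnn n).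
  have -> : x = y - (y - x) by rewrite subKr.
  by apply: idealD => //; apply: idealN; exact: BA.
- elim: n A BA => [|n IHn] A BA /=; last first.
    move=> [L [hL [LA AL]]]; have BL := ideal_chain_sub hL.
    have [c [cP cS]] := IHn L BL hL.
    (* The chain obtained for [L] receives [A / B] as its new top term. *)
    exists (fun i => if (i <= n)%N then c i else subquot A B); split=> i ile.
      case: ifP => [/cP[? cL]|_]; last first.
        split=> //; split=> [|k u v]; rewrite !in_setE.
          by exists 0; [exact: ideal0|exact: quot_pi0].
        move=> [x Ax <-] [y Ay <-]; exists (k * x + y).
          by apply: idealD => //; exact: idealM.
        by rewrite quot_piD -quot_scale_pi.
      by split=> // u /cL[x Lx <-]; exists x => //; exact: LA.
    rewrite (ile : (i <= n)%N); have [ilt|nle] := ltnP i n; first exact: cS.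
    have -> : i = n by lia.
    have [_ cL] := cP n (leqnn n).
    split=> [u /cL[x Lx <-]|h]; first by exists x => //; exact: LA.
    apply: AL => x Ax.
    have /h/cL[y Ly /eqP/quot_eqP Byx] : subquot A B (\pi_(quot B) x) by exists x.
    have -> : x = y - (y - x) by rewrite subKr.
    by apply: idealD => //; apply: idealN; exact: BL.
  move=> _; exists (fun=> subquot A B); split=> // i _; split=> //.
  split=> [|k u v]; rewrite !in_setE.
    by exists 0; [exact: ideal0|exact: quot_pi0].
  move=> [x Ax <-] [y Ay <-]; exists (k * x + y).
    by apply: idealD => //; exact: idealM.
  by rewrite quot_piD -quot_scale_pi.
Qed.

Lemma is_length_len A B n : is_length A B n -> len A B = n.
Proof.
move=> [hn nmax]; have eq := subquotP (ideal_chain_sub hn).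
apply: xget_unique => [|k [ck kmax]].
  by split=> [|k c hc]; [exact/eq|apply: nmax; apply/eq; exists c].
apply/eqP; rewrite eqn_leq nmax ?eq//=; last exact/eq.
by have /eq[c hc] := hn; exact: kmax hc.
Qed.

Lemma lenP A B : B `<=` A -> finite_length A B -> is_length A B (len A B).
Proof. by move=> BA /(finite_lengthP BA)[n hn]; rewrite (is_length_len hn). Qed.

(** Concatenating maximal chains gives one inequality; splitting any chain along [B] gives the
    other. *)
Lemma len_add A B C : C `<=` B -> B `<=` A -> finite_length A C ->
  len A C = (len A B + len B C)%N.
Proof.
move=> CB BA fAC; apply: is_length_len.
have fAB : finite_length A B by exact: finite_lengthS fAC.
have fBC : finite_length B C by exact: finite_lengthS fAC.
have [cAB mAB] := lenP BA fAB; have [cBC mBC] := lenP CB fBC.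
split=> [|k]; first by rewrite addnC; exact: ideal_chain_cat cAB.
move=> /(ideal_chain_split CB)[i [j [-> hi hj]]]; rewrite addnC.
apply: leq_add; [apply: mAB|apply: mBC].
  by apply: ideal_chainW hj => //; apply/ideal_add_sub; split.
by apply: ideal_chainW hi => // x [].
Qed.

Lemma len_eq0_sub A B : B `<=` A -> finite_length A B -> len A B = 0%N -> A `<=` B.
Proof.
move=> BA /(lenP BA)[_ +] len0; rewrite len0 => mAB.
apply: contrapT => nAB; suff: (1 <= 0)%N by [].
by apply: mAB; exists B; split=> //; split.
Qed.

Section Transport.
Variables (A B A' B' : ideal R) (f : ideal R -> ideal R).
Hypothesis f_proper : forall L M, B `<=` L -> M `<=` A -> L `<` M -> f L `<` f M.
Hypotheses (fB : B' `<=` f B) (fA : f A `<=` A').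
Hypothesis fS : forall L M, L `<=` M -> f L `<=` f M.

(** Strictness is only asked between [B] and [A], because the maps [M |-> A n (M : x)] and
    [L |-> xL + B] to which this is applied need not be strict elsewhere. *)
Lemma ideal_chain_map n : ideal_chain n B A -> ideal_chain n B' A'.
Proof.
move=> h; apply: ideal_chainW fB fA _.
have : A `<=` A by []. move: h; move: {1 2 4}A.
elim: n => [|n IHn] M /=; first by move=> ? _; exact: fS.
move=> [L [hL LM]] MA; exists (f L); split.
  by apply: IHn => //; case: LM => LM _; exact: subset_trans MA.
by apply: f_proper => //; exact: ideal_chain_sub hL.
Qed.
End Transport.

(* The isomorphism [(xA + B)/B = A/(A n (B : x))] induced by multiplication by
   [x], on submodule lattices. *)
Lemma ideal_chain_mul x A B n :
  ideal_chain n B (princ x * A + B) <-> ideal_chain n (ideal_cap A (colon B x)) A.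
Proof.
split; [apply: (@ideal_chain_map _ _ _ _ (fun M => ideal_cap A (colon M x)))
       |apply: (@ideal_chain_map _ _ _ _ (fun L => princ x * L + B))] => //.
- move=> L M BL MA [LM ML]; split=> [y [Ay /LM]//|h]; apply: ML => y My.
  have /mem_princ_mul_add[t [z [At Bz yE]]] := MA _ My.
  suff [_ Lxt] : ideal_set (ideal_cap A (colon L x)) t.
    by rewrite yE; apply: idealD => //; exact: BL.
  apply: h; split=> //=; have -> : x * t = y - z by rewrite yE addrK.
  by apply: idealD => //; apply: idealN; exact/LM/BL.
- by move=> y [].
- by move=> L M LM y [Ay /LM].
- move=> L M BL MA [LM ML]; split=> [|h].
    by apply: ideal_addS => //; exact: ideal_mulS.
  apply: ML => y My.
  have /h/mem_princ_mul_add[t [z [Lt Bz E]]] : ideal_set (princ x * M + B) (x * y).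
    by apply: mem_ideal_addl; apply/mem_princ_mul; exists y.
  suff : ideal_set L (y - t) by move=> /(idealD Lt); rewrite subrKC.
  apply: BL; split => /=.
    by apply: idealD; [exact: MA|apply/idealN/MA/LM].
  by rewrite mulrBr E addrC addKr.
- by move=> y By; exact: mem_ideal_addr.
- by move=> L M LM; apply: ideal_addS => //; exact: ideal_mulS.
Qed.

Lemma finite_length_mul x A B :
  finite_length (princ x * A + B) B <-> finite_length A (ideal_cap A (colon B x)).
Proof. by split=> -[n hn]; exists n => k /ideal_chain_mul/hn. Qed.

Lemma len_mul x A B : finite_length (princ x * A + B) B ->
  len (princ x * A + B) B = len A (ideal_cap A (colon B x)).
Proof.
move=> /lenP; rewrite /is_length => -[|c mx]; first exact: mem_ideal_addr.
by apply/esym/is_length_len; split=> [|k /ideal_chain_mul/mx//]; exact/ideal_chain_mul.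
Qed.

(* [E < E + (x^n)] with quotient [R/(E : x^n)], and [(E : x^n)] contains
   [E + (x)] if [x^(n+1)] is in [E]. *)
Lemma finite_length_nilpotent x E : radical E x ->
  finite_length 1 (princ x + E) -> finite_length 1 E.
Proof.
move=> [n]; elim: n E => [|n IHn] E.
  rewrite expr0 => E1 _; exists 0%N => -[//|k] [L [/ideal_chain_sub EL [_]]] [].
  by move=> y _; apply: EL; rewrite -[y]mulr1; exact: idealM.
move=> Exn fE; apply: (@finite_length_trans _ (princ (x ^+ n) * 1 + E)) => //.
- exact: mem_ideal_addr.
- apply: IHn.
    apply: mem_ideal_addl; apply/mem_princ_mul; exists 1 => //.
    by rewrite mulr1.
  by apply: finite_lengthS fE => //; apply: ideal_addS => //; exact: mem_ideal_addr.
- apply/finite_length_mul; apply: finite_lengthS fE => // y.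
  move=> /mem_ideal_add[u [v [/mem_princ[t ->] Ev ->]]]; split=> //=.
  rewrite mulrDr mulrA -exprSr; apply: idealD; last exact: idealM.
  by rewrite mulrC; exact: idealM.
Qed.

(** The quotient by [m] has length at most 1, and [m] has finitely many generators, each nilpotent
    modulo [E]. By induction on the list of generators, [E + (x)] has finite colength, and
    [finite_length_nilpotent] removes [x]. *)
Lemma finite_length_radical (m E : ideal R) :
  noetherian R -> maximal_ideal m -> m `<=` radical E -> finite_length 1 E.
Proof.
move=> noeth [m1 mmax] mE; have [s ms] := noeth m.
have fm : finite_length 1 m.
  exists 1%N => -[//|[//|k]] [L [[M [/ideal_chain_sub mM [ML LM]]] [L1 nL1]]].
  have [LE|LE] := mmax L (subset_trans mM ML); last by case: nL1; rewrite LE.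
  by case: LM; rewrite LE.
have : m `<=` (ideal_gen [set` s] + E : ideal R).
  by rewrite -ms; exact: mem_ideal_addl.
have : {subset s <= radical E}.
  by move=> x xs; rewrite in_setE; apply: mE; rewrite ms; exact: sub_ideal_gen.
elim: s E {ms mE} => [|x s IHs] E sE mE.
  apply: finite_lengthS fm => // y /mE /mem_ideal_add[u [v [u0 Ev ->]]].
  apply: idealD => //; move: u u0; apply: ideal_gen_sub => //.
apply: (@finite_length_nilpotent x).
  by have := sE x (mem_head _ _); rewrite in_setE.
apply: IHs => [y ys|].
  have := sE y; rewrite inE ys orbT !in_setE => /(_ isT)[n Eyn].
  by exists n; exact: mem_ideal_addr.
apply: subset_trans mE _; rewrite addrA; apply: ideal_addS => //.
apply: ideal_gen_sub => y ys.
have /orP[/eqP ->|{}ys] : (y == x) || (y \in s) by rewrite -in_cons.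
  by apply: mem_ideal_addr; exact: sub_ideal_gen.
by apply: mem_ideal_addl; apply: sub_ideal_gen.
Qed.

End IdealChains.

(** * Regular sequences and the Koszul sequence *)

Section KoszulLength.
Variable R : comNzRingType.
Implicit Types (A B C E I J m : ideal R) (x y c d : R).

Lemma lenxx A : len A A = 0%N.
Proof.
apply: is_length_len; split=> // -[//|k] [L [/ideal_chain_sub AL [_ nAL]]].
by case: nAL.
Qed.

Lemma len_le A A' B : B `<=` A -> A `<=` A' -> finite_length A' B ->
  (len A B <= len A' B)%N.
Proof.
move=> BA AA' fA'; have fA : finite_length A B by exact: finite_lengthS fA'.
have [_] := lenP (subset_trans BA AA') fA'; apply.
by have [hA _] := lenP BA fA; exact: ideal_chainW hA.
Qed.

(** Vanishing of the first Koszul homology of [x, y]: every relation is a multiple of the trivial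
    one. *)
Definition no_syzygy x y :=
  forall t z, x * t = y * z -> exists w, t = y * w /\ z = x * w.

(* If [c, d] is a regular sequence in [(x, y)] and [xt = yz], then with
   [c = px + qy] the element [w = pz + qt] satisfies [ct = yw], [cz = xw], and
   [dw] is a multiple of [c]; hence so is [w]. *)
Lemma no_syzygy_regular x y c d :
  (forall u, c * u = 0 -> u = 0) ->
  (forall u v, d * u = c * v -> exists w, u = c * w) ->
  ideal_set (princ x + princ y) c -> ideal_set (princ x + princ y) d ->
  no_syzygy x y.
Proof.
move=> c_reg d_reg /mem_ideal_add[_ [_ [/mem_princ[p ->] /mem_princ[q ->] cE]]].
move=> /mem_ideal_add[_ [_ [/mem_princ[p' ->] /mem_princ[q' ->] dE]]] t z xt.
have cI u v : c * u = c * v -> u = v.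
  by move=> cuv; apply/subr0_eq/c_reg; rewrite mulrBr cuv subrr.
have ct : c * t = y * (p * z + q * t).
  have -> : c * t = p * (x * t) + q * (y * t) by rewrite cE; ring.
  by rewrite xt; ring.
have cz : c * z = x * (p * z + q * t).
  have -> : c * z = p * (x * z) + q * (y * z) by rewrite cE; ring.
  by rewrite -xt; ring.
have [w wE] : exists w, p * z + q * t = c * w.
  apply: (d_reg _ (p' * z + q' * t)).
  have -> : c * (p' * z + q' * t) = p' * (c * z) + q' * (c * t) by ring.
  by rewrite cz ct dE; ring.
exists w; split; apply: cI; [rewrite ct wE|rewrite cz wE]; ring.
Qed.

(** Powers of a regular sequence stay regular. Induction on [j] treats [d ^+ j] modulo [c]; then one
    factor [c] at a time is split off [u] and cancelled. *)
Lemma regularX c d i j :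
  (forall u, c * u = 0 -> u = 0) ->
  (forall u v, d * u = c * v -> exists w, u = c * w) ->
  (forall u, c ^+ i * u = 0 -> u = 0) /\
  (forall u v, d ^+ j * u = c ^+ i * v -> exists w, u = c ^+ i * w).
Proof.
move=> c_reg d_reg.
have cI u v : c * u = c * v -> u = v.
  by move=> cuv; apply/subr0_eq/c_reg; rewrite mulrBr cuv subrr.
have d_regX u v : d ^+ j * u = c * v -> exists w, u = c * w.
  elim: j u v => [|j IHj] u v; first by rewrite expr0 mul1r => ->; exists v.
  by rewrite exprS -mulrA => /d_reg[w /IHj].
split; elim: i => [|i IHi] u; first by rewrite expr0 mul1r.
- by rewrite exprS -mulrA => /c_reg/IHi.
- by exists u; rewrite expr0 mul1r.
move=> v duv; have [w uE] : exists w, u = c * w.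
  by apply: (d_regX _ (c ^+ i * v)); rewrite duv exprS mulrA.
have [w' wE] : exists w', w = c ^+ i * w'.
  by apply: (IHi _ v); apply: cI; rewrite mulrCA -uE duv exprS mulrA.
by exists w'; rewrite uE wE exprS mulrA.
Qed.

(** The two quotients in [regular_sequence] are by the zero ideal and by [(c)]; injectivity there is
    rewritten as equations in [R]. *)
Lemma regular_sequence2 c d : regular_sequence [:: c; d] ->
  (forall u, c * u = 0 -> u = 0) /\
  (forall u v, d * u = c * v -> exists w, u = c * w).
Proof.
move=> [reg _]; have := reg 1%N isT; have := reg 0%N isT.
rewrite /=; set Z := ideal_gen _; set P := ideal_gen _ => c_inj d_inj.
have Z0 u : ideal_set Z u -> u = 0.
  suff : Z `<=` (0 : ideal R) by move=> /(_ u) h /h.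
  by apply: ideal_gen_sub.
have Pc u : ideal_set P u -> exists w, u = c * w.
  suff : P `<=` princ c by move=> /(_ u) h /h/mem_princ.
  apply: ideal_gen_sub => v; rewrite /= inE => /eqP ->.
  by apply/mem_princ; exists 1; rewrite mulr1.
have reg0 (K : ideal R) f u :
    injective (fun x : quot K => f *: x) -> ideal_set K (f * u) -> ideal_set K u.
  move=> f_inj Kfu; suff /eqP/quot_eqP : \pi_(quot K) u = \pi_(quot K) 0.
    by rewrite subr0.
  apply: f_inj; rewrite -[LHS]/(quot_scale f _) -[RHS]/(quot_scale f _).
  by rewrite !quot_scale_pi; apply/eqP/quot_eqP; rewrite mulr0 subr0.
split=> [u cu|u v duv].
  by apply: Z0; apply: (reg0 Z c u c_inj); rewrite cu; exact: ideal0.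
apply: Pc; apply: (reg0 P d u d_inj); rewrite duv mulrC; apply: idealM.
by apply: sub_ideal_gen; rewrite /= inE.
Qed.

Local Notation colen E := (len (1 : ideal R)%R E%R).

Section TwoElements.
Variables (x y : R) (A B : ideal R).
Hypothesis xy_exact : no_syzygy x y.

Let Q := princ x + princ y.
Let D := princ x * A + princ y * B.
Let F := ideal_cap (colon B x) (colon A y).

Hypotheses (fA : finite_length 1 A) (fB : finite_length 1 B).
Hypothesis fD : finite_length 1 D.

(* The Koszul exact sequence [0 -> R/F -> R/A + R/B -> Q/D -> 0], with
   [R/A + R/B -> Q/D] sending [(u, v)] to [xu + yv]. *)
Lemma koszul_len : (colen A + colen B = len Q D + colen F)%N.
Proof.
(* [D1] is inserted between [D] and [Q] so that each step is the image of a multiplication: by [x]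
   onto [Q / D1], by [y] onto [D1 / D]. The absence of syzygies computes the two kernels. *)
pose T := colon A y; pose D1 := princ x * A + princ y * 1.
have DD1 : D `<=` D1 by apply: ideal_addS => //; exact: ideal_mulS.
have add1 K : 1 + K = 1 :> ideal R.
  by apply: ideal_eq => // z _; exact: mem_ideal_addl.
have QE : Q = princ x * 1 + D1 by rewrite /D1 addrA -mulrDr add1 !mulr1.
have D1E : D1 = princ y * 1 + D by rewrite /D1 /D addrCA -mulrDr add1.
have AT : A `<=` T by move=> z Az; rewrite /T colonE; exact: idealM.
have colD1 : ideal_cap 1 (colon D1 x) = princ y * 1 + A.
  apply: ideal_eq => z.
    move=> [_ /mem_princ_mul_add[t [_ [At /mem_princ_mul[v _ ->] xz]]]].
    have [|w [ztE _]] := @xy_exact (z - t) v.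
      by rewrite mulrBr xz addrC addKr.
    by apply/mem_princ_mul_add; exists w, t; rewrite -ztE subrK.
  move=> /mem_princ_mul_add[w [t [_ At ->]]]; split=> //.
  rewrite colonE; apply/mem_princ_mul_add.
  exists t, (y * (x * w)); split=> //; last by ring.
  by apply/mem_princ_mul; exists (x * w).
have colD : ideal_cap 1 (colon D y) = princ x * T + B.
  apply: ideal_eq => z.
    move=> [_ /mem_princ_mul_add[t [_ [At /mem_princ_mul[v Bv ->] yz]]]].
    have [|w [tE zvE]] := @xy_exact t (z - v).
      by rewrite mulrBr yz addrK.
    apply/mem_princ_mul_add; exists w, v; split=> //; last by rewrite -zvE subrK.
    by rewrite /T colonE -tE.
  move=> /mem_princ_mul_add[w [v [Tw Bv ->]]]; split=> //.
  rewrite colonE; apply/mem_princ_mul_add.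
  exists (y * w), (y * v); split=> //; last by ring.
  by apply/mem_princ_mul; exists v.
have capT K : ideal_cap 1 K = K :> ideal R by apply: ideal_eq => // z [].
have fD1 : finite_length 1 D1 by exact: finite_lengthS fD.
have lQD : len Q D = (colen (princ y * 1 + A)
                      + colen (princ x * T + B))%N.
  rewrite (@len_add _ Q D1 D) ?QE//; last by exact: finite_lengthS fD.
  + rewrite len_mul; last by exact: finite_lengthS fD1.
    rewrite colD1; congr addn; rewrite [in len D1 _]D1E len_mul ?colD//.
    by exact: finite_lengthS fD.
  + by move=> z; exact: mem_ideal_addr.
(* Filter [R/A] through [(y) + A] and [R/B] through [xT + B]. The lower pieces are [R/T] and [T/F],
   whose lengths add up to that of [R/F]; the upper ones add up to that of [Q/D]. *)
have lA : colen A = (colen (princ y * 1 + A) + colen T)%N.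
  rewrite (@len_add _ 1 (princ y * 1 + A) A)//; last exact: mem_ideal_addr.
  by rewrite len_mul ?capT//; exact: finite_lengthS fA.
have lB : colen B = (colen (princ x * T + B)
                     + len T (ideal_cap T (colon B x)))%N.
  rewrite (@len_add _ 1 (princ x * T + B) B)//; last exact: mem_ideal_addr.
  by rewrite len_mul//; exact: finite_lengthS fB.
have FE : F = ideal_cap T (colon B x) by apply: ideal_eq => z [].
have lF : colen F = (colen T + len T F)%N.
  apply: len_add => //; first by rewrite FE => z [].
  apply: (@finite_length_trans _ _ T) => //; first by rewrite FE => z [].
    exact: finite_lengthS fA.
  by rewrite FE; apply/finite_length_mul; exact: finite_lengthS fB.
by rewrite lA lB lQD lF FE; lia.
Qed.

(** Additivity trades [Q/D] for colengths in [R]. It is used with [N] and [D] the numerator and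
    denominator of [M1] and with [C = I^r J^s]. *)
Lemma koszul_len_alternating (C N : ideal R) :
  C `<=` F -> D `<=` N -> finite_length 1 C ->
  (colen A + colen B + colen Q + len F C = colen N + len N D + colen C)%N.
Proof.
move=> CF DN fC.
have DQ : D `<=` Q.
  by apply: ideal_addS; rewrite -[X in _ `<=` ideal_set X]mulr1; exact: ideal_mulS.
have lQ : colen D = (colen Q + len Q D)%N by exact: len_add.
have lN : colen D = (colen N + len N D)%N by exact: len_add.
have lC : colen C = (colen F + len F C)%N by exact: len_add.
by have := koszul_len; lia.
Qed.

End TwoElements.
End KoszulLength.

(** * Radicals of products and powers *)

Section Radicals.
Variable R : comNzRingType.
Implicit Types A B m : ideal R.

Lemma radicalS A B : A `<=` B -> radical A `<=` radical B.
Proof. by move=> AB x [n /AB]; exists n. Qed.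

Lemma sub_radical_mul m A B :
  m `<=` radical A -> m `<=` radical B -> m `<=` radical (A * B : ideal R).
Proof.
move=> mA mB x mx; have [i Ai] := mA x mx; have [j Bj] := mB x mx.
by exists (i + j)%N; rewrite exprD; exact: mem_ideal_mul.
Qed.

Lemma sub_radical_exp m A n : m `<=` radical A -> m `<=` radical (A ^+ n : ideal R).
Proof.
move=> mA; elim: n => [|n IHn]; first by rewrite expr0 => x _; exists 0%N.
by rewrite exprS; exact: sub_radical_mul.
Qed.

End Radicals.

(** * Joint reductions *)

Section JointReductionPowers.
Variables (R : comNzRingType) (I J : ideal R) (a b : R).
Hypotheses (Ia : ideal_set I a) (Jb : ideal_set J b).

Lemma M1_den_sub_num r s k : M1_den I J a b r s k `<=` M1_num I J r s k.
Proof.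
apply/ideal_add_sub; split.
  rewrite /M1_num [I ^+ (r + k)]exprD [I ^+ r * _]mulrC.
  by do 2!apply: ideal_mulS => //; exact: princ_subX.
rewrite /M1_num [J ^+ (s + k)]exprD -mulrA mulrCA [J ^+ s * _]mulrC.
by do 2!apply: ideal_mulS => //; exact: princ_subX.
Qed.

(** Each use of the reduction equation trades a factor [I] for [a] or a factor [J] for [b]; it is
    repeated until [a ^+ k] or [b ^+ k] is complete. *)
Lemma reduction_eq_pow N r s k :
  (forall r s, (N <= r)%N -> (N <= s)%N -> reduction_eq I J a b r s) ->
  (N <= r)%N -> (N <= s)%N -> M1_num I J r s k = M1_den I J a b r s k.
Proof.
move=> red Nr Ns; apply: ideal_eq; last exact: M1_den_sub_num.
(* Here [p] and [q] count the trades towards [a] and [b] that are still missing; the claim is the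
   case [p = q = k]. *)
suff main p q : (p <= k)%N -> (q <= k)%N ->
    (princ (a ^+ (k - p)) * princ (b ^+ (k - q)) * (I ^+ (r + p) * J ^+ (s + q))
      : ideal R) `<=` M1_den I J a b r s k.
  by have := main k k (leqnn k) (leqnn k); rewrite subnn !expr0 princ1 !mul1r.
elim: p q => [|p IHp] q.
  move=> _ qk; rewrite subn0 addn0; apply: subset_trans (@mem_ideal_addl _ _ _).
  have -> : princ (a ^+ k) * princ (b ^+ (k - q)) * (I ^+ r * J ^+ (s + q)) =
    princ (a ^+ k) * I ^+ r * (princ (b ^+ (k - q)) * J ^+ (s + q)) by ring.
  apply: ideal_mulS => //; have -> : (s + k = (k - q) + (s + q))%N by lia.
  by rewrite [J ^+ (k - q + _)]exprD; apply: ideal_mulS => //; exact: princ_subX.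
move=> pk; elim: q => [|q IHq] qk.
  rewrite subn0 addn0; apply: subset_trans (@mem_ideal_addr _ _ _).
  have -> : princ (a ^+ (k - p.+1)) * princ (b ^+ k) * (I ^+ (r + p.+1) * J ^+ s) =
    princ (b ^+ k) * (princ (a ^+ (k - p.+1)) * I ^+ (r + p.+1)) * J ^+ s by ring.
  apply: ideal_mulS => //; apply: ideal_mulS => //.
  have -> : (r + k = (k - p.+1) + (r + p.+1))%N by lia.
  by rewrite [I ^+ (k - p.+1 + _)]exprD; apply: ideal_mulS => //; exact: princ_subX.
(* The reduction equation at [(r + p, s + q)] leaves an [a]-term with [p] lowered by one and a
   [b]-term with [q] lowered by one. *)
rewrite !addnS red; [|lia..].
have -> : princ (a ^+ (k - p.+1)) * princ (b ^+ (k - q.+1)) *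
    (princ a * I ^+ (r + p) * J ^+ (s + q).+1 +
     princ b * I ^+ (r + p).+1 * J ^+ (s + q)) =
  princ (a ^+ (k - p.+1)) * princ a * princ (b ^+ (k - q.+1)) *
     (I ^+ (r + p) * J ^+ (s + q).+1) +
  princ (a ^+ (k - p.+1)) * (princ (b ^+ (k - q.+1)) * princ b) *
     (I ^+ (r + p).+1 * J ^+ (s + q)) by ring.
rewrite !princM -!exprSr -!subSn// !subSS -!addnS -!princM.
apply/ideal_add_sub; split; last by apply: IHq; exact: ltnW.
by apply: IHp => //; exact: ltnW pk.
Qed.

Definition Ftilde_at r s k : ideal R :=
  ideal_cap (colon (I ^+ (r + k) * J ^+ s) (a ^+ k))
            (colon (I ^+ r * J ^+ (s + k)) (b ^+ k)).

Lemma Ftilde_at_mono r s k l : (k <= l)%N -> Ftilde_at r s k `<=` Ftilde_at r s l.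
Proof.
move=> kl x [Ix Jx]; have expE z : z ^+ l = z ^+ (l - k) * z ^+ k :> R.
  by rewrite -exprD subnK.
split; rewrite colonE.
  have -> : I ^+ (r + l) * J ^+ s = I ^+ (l - k) * (I ^+ (r + k) * J ^+ s).
    by rewrite mulrA -exprD; congr (_ ^+ _ * _); lia.
  by rewrite expE -mulrA; apply: mem_ideal_mul => //; exact: mem_idealX.
have -> : I ^+ r * J ^+ (s + l) = J ^+ (l - k) * (I ^+ r * J ^+ (s + k)).
  by rewrite mulrCA -exprD; congr (_ * _ ^+ _); lia.
by rewrite expE -mulrA; apply: mem_ideal_mul => //; exact: mem_idealX.
Qed.

Lemma sub_Ftilde_at r s k : (I ^+ r * J ^+ s : ideal R) `<=` Ftilde_at r s k.
Proof.
(* The term of index 0 is [I^r J^s] itself, so monotonicity in [k] suffices. *)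
have -> : I ^+ r * J ^+ s = Ftilde_at r s 0.
  apply: ideal_eq => x; rewrite /Ftilde_at !addn0.
    by move=> hx; split; rewrite colonE expr0 mul1r.
  by case; rewrite !colonE expr0 mul1r.
exact: Ftilde_at_mono.
Qed.

(** The union is increasing, so two elements lie in a common term. *)
Lemma is_ideal_Ftilde r s : is_ideal (Ftilde I J a b r s).
Proof.
split=> [|x y [k /= k1 hx] [l /= l1 hy]|c x [k /= k1 hx]].
- by exists 1%N => //=; exact: (ideal0 (Ftilde_at r s 1)).
- exists (maxn k l); first by rewrite /= leq_max k1.
  apply: (@idealD _ (Ftilde_at r s (maxn k l))).
    by apply: (Ftilde_at_mono (leq_maxl k l)).
  by apply: (Ftilde_at_mono (leq_maxr k l)).
- by exists k => //; apply: (@idealM _ (Ftilde_at r s k)).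
Qed.

Lemma Ftilde_at_sub r s k : (0 < k)%N -> Ftilde_at r s k `<=` Ftilde I J a b r s.
Proof. by move=> k0 x hx; exists k. Qed.

End JointReductionPowers.

Lemma sup_chain_length_unique (T : Type) (P : set (set T)) n k :
  sup_chain_length P n -> sup_chain_length P k -> n = k.
Proof.
move=> [[c hc] nmax] [[d hd] kmax]; apply/eqP; rewrite eqn_leq.
by rewrite (kmax _ _ hc) (nmax _ _ hd).
Qed.

Lemma M1_denE (R : comNzRingType) (I J : ideal R) (a b : R) r s k :
  M1_den I J a b r s k =
  princ (a ^+ k) * (I ^+ r * J ^+ (s + k)) + princ (b ^+ k) * (I ^+ (r + k) * J ^+ s).
Proof. by rewrite /M1_den -!mulrA. Qed.

(** * Finite colengths and the mixed difference in dimension two *)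

Section JointReductionLength.
Variables (R : comNzRingType) (m I J : ideal R) (a b : R).
Hypotheses (R_CM : cohen_macaulay_local m) (R_dim2 : krull_dim R 2).
Hypotheses (I_primary : primary_to m I) (J_primary : primary_to m J).
Hypothesis ab_joint : joint_reduction I J a b.

Let Ia : ideal_set I a. Proof. by case: ab_joint. Qed.
Let Jb : ideal_set J b. Proof. by case: ab_joint. Qed.

Lemma sub_radical_IJ r s : m `<=` radical (I ^+ r * J ^+ s : ideal R).
Proof.
have [_ _ rI] := I_primary; have [_ _ rJ] := J_primary.
by apply: sub_radical_mul; apply: sub_radical_exp; rewrite ?rI ?rJ.
Qed.

(** By [reduction_eq_pow], the ideal [(a^k, b^k)] contains a product of high powers of [I] and
    [J]. *)
Lemma sub_radical_ab k : m `<=` radical (princ (a ^+ k) + princ (b ^+ k) : ideal R).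
Proof.
have [_ _ [N red]] := ab_joint.
apply: subset_trans (@sub_radical_IJ (N + k) (N + k)) _; apply: radicalS.
have := reduction_eq_pow Ia Jb k red (leqnn N) (leqnn N); rewrite /M1_num => ->.
by apply: ideal_addS; rewrite -mulrA -[X in _ `<=` ideal_set X]mulr1; exact: ideal_mulS.
Qed.

Lemma finite_length_m_radical E : m `<=` radical (E : ideal R) -> finite_length 1 E.
Proof. by have [noeth [mm _] _] := R_CM; exact: finite_length_radical. Qed.

(** The depth equals the dimension 2, so [m] contains a regular sequence of length two. Suitable
    powers of its terms lie in [(a^k, b^k)] and are still regular. *)
Lemma no_syzygy_ab k : no_syzygy (a ^+ k) (b ^+ k).
Proof.
have [_ _ [d [dim_d depth_d]]] := R_CM.
have d2 : d = 2 := sup_chain_length_unique dim_d R_dim2; subst d.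
have [[s [s_reg sm s2]] _] := depth_d.
case: s s2 s_reg sm => [|x [|y [|//]]] // _ s_reg sm.
have [x_reg y_reg] := regular_sequence2 s_reg.
have [i Qx] : radical (princ (a ^+ k) + princ (b ^+ k) : ideal R) x.
  by apply/sub_radical_ab/sm; rewrite /= inE eqxx.
have [j Qy] : radical (princ (a ^+ k) + princ (b ^+ k) : ideal R) y.
  by apply/sub_radical_ab/sm; rewrite /= !inE eqxx orbT.
have [xi_reg yj_reg] := regularX i j x_reg y_reg.
exact: no_syzygy_regular xi_reg yj_reg Qx Qy.
Qed.

(** For any ideals [A] and [B], [a^k A + b^k B] contains [(a^k, b^k) A B], a product of ideals whose
    radicals contain [m]. *)
Lemma finite_length_M1_den r s k : finite_length 1 (M1_den I J a b r s k).
Proof.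
apply: finite_length_m_radical.
have := sub_radical_mul (@sub_radical_ab k)
  (sub_radical_mul (@sub_radical_IJ r (s + k)) (@sub_radical_IJ (r + k) s)).
move/subset_trans; apply; apply: radicalS; rewrite M1_denE mulrDl.
apply: ideal_addS; apply: ideal_mulS => //; apply/ideal_mul_sub => u v Au Bv.
  by rewrite [u * v]mulrC; exact: idealM.
exact: idealM.
Qed.

Lemma bilen_mixed_difference r s k :
  bilen I J r (s + k) + bilen I J (r + k) s
    + (len (1 : ideal R) (princ (a ^+ k) + princ (b ^+ k) : ideal R))%:Z
    + (len (Ftilde_at I J a b r s k) (I ^+ r * J ^+ s))%:Z =
  bilen I J (r + k) (s + k) + (len (M1_num I J r s k) (M1_den I J a b r s k))%:Z
    + bilen I J r s.
Proof.
have fIJ i j : finite_length 1 (I ^+ i * J ^+ j : ideal R).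
  by apply: finite_length_m_radical; exact: sub_radical_IJ.
have fD := finite_length_M1_den r s k.
rewrite M1_denE in fD.
have := koszul_len_alternating (@no_syzygy_ab k) (fIJ _ _) (fIJ _ _) fD
  (@sub_Ftilde_at _ I J a b Ia Jb r s k) _ (fIJ r s).
rewrite -M1_denE => /(_ _ (@M1_den_sub_num _ I J a b Ia Jb r s k)).
by move=> /(congr1 Posz); rewrite !PoszD.
Qed.

End JointReductionLength.

(** * Hilbert polynomials *)

Section HilbertPolynomials.
Implicit Types (n : nat) (A B C : int).

Lemma bin2Z n : 2 * 'C(n + 1, 2)%:Z = n%:Z * (n%:Z + 1).
Proof. by have := mul_bin_diag n.+1 1; rewrite /= bin1 addn1; lia. Qed.

(** Evaluation at three consecutive integers: the second difference isolates [A], then the first one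
    [B]. *)
Lemma large_quadratic_eq0 A B C :
  for_large (fun n => A * 'C(n + 1, 2)%:Z + B * n%:Z + C = 0) ->
  [/\ A = 0, B = 0 & C = 0].
Proof.
move=> [N hN].
have h n : (N <= n)%N -> A * (n%:Z * (n%:Z + 1)) + 2 * B * n%:Z + 2 * C = 0.
  move=> /hN e; rewrite -bin2Z.
  suff -> : A * (2 * 'C(n + 1, 2)%:Z) + 2 * B * n%:Z + 2 * C =
    2 * (A * 'C(n + 1, 2)%:Z + B * n%:Z + C) by rewrite e mulr0.
  ring.
have h0 := h N (leqnn _); have h1 := h N.+1 (leqW (leqnn _)).
have h2 := h N.+2 (leqW (leqW (leqnn _))).
rewrite -[N.+2]addn2 -[N.+1]addn1 !PoszD in h1 h2.
have A0 : A = 0 by (suff : 2 * A = 0 by lia); lra.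
subst A; have B0 : B = 0 by (suff : 2 * B = 0 by lia); lra.
by subst B; split=> //; lia.
Qed.

Variables (R : comNzRingType) (I J : ideal R).

Lemma bigraded_hilbertE e : bigraded_hilbert_coeffs I J e ->
  for_large2 (fun r s => bilen I J r s =
    e 2%N 0%N * 'C(r + 1, 2)%:Z + e 0%N 2%N * 'C(s + 1, 2)%:Z + e 1%N 1%N * r%:Z * s%:Z
    - e 1%N 0%N * r%:Z - e 0%N 1%N * s%:Z + e 0%N 0%N).
Proof.
move=> [N hN]; exists N => r s /hN h /h ->.
have sub1 n : (n + 2 - 1 = n + 1)%N by lia.
rewrite !big_ord_recl big_ord0 /bump /=.
do 3!rewrite big_mkcond !big_ord_recl big_ord0 /bump /= ?addn0 ?add1n.
(* Where the upper index [r + 0 - 1] or [s + 0 - 1] occurs, the lower index is 0 and the binomial is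
   1. *)
rewrite ?sub1 ?bin0 ?addnK ?bin1.
ring.
Qed.

(** On one fixed row [N] far enough out, both formulas are polynomials in [s], and their leading
    coefficients are compared. *)
Lemma row_hilbert_lead e e0 g1 g2 :
  bigraded_hilbert_coeffs I J e -> row_hilbert_coeffs I J e0 g1 g2 ->
  e 0%N 2%N = e0.
Proof.
move=> /bigraded_hilbertE[N hN] row; have [N' hN'] := row N.
have [] := @large_quadratic_eq0 (e 0%N 2%N - e0) (e 1%N 1%N * N%:Z - e 0%N 1%N + g1 N)
  (e 2%N 0%N * 'C(N + 1, 2)%:Z - e 1%N 0%N * N%:Z + e 0%N 0%N - g2 N);
  last by move/subr0_eq.
exists (maxn N N') => s; rewrite geq_max => /andP[/(hN N s (leqnn N)) h /hN' h'].
by rewrite h in h'; lra.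
Qed.

Lemma col_hilbert_lead e e0 h1 h2 :
  bigraded_hilbert_coeffs I J e -> col_hilbert_coeffs I J e0 h1 h2 ->
  e 2%N 0%N = e0.
Proof.
move=> /bigraded_hilbertE[N hN] col; have [N' hN'] := col N.
have [] := @large_quadratic_eq0 (e 2%N 0%N - e0) (e 1%N 1%N * N%:Z - e 1%N 0%N + h1 N)
  (e 0%N 2%N * 'C(N + 1, 2)%:Z - e 0%N 1%N * N%:Z + e 0%N 0%N - h2 N);
  last by move/subr0_eq.
exists (maxn N N') => r; rewrite geq_max => /andP[/(hN r N)/(_ (leqnn N)) h /hN' h'].
by rewrite h in h'; lra.
Qed.

(** On the diagonal [r = s = n] both formulas compute the colength of [(IJ)^n]. *)
Lemma hilbert_const e eIJ :
  bigraded_hilbert_coeffs I J e -> hilbert_coeffs (I * J) eIJ ->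
  e 0%N 0%N = eIJ 2%N.
Proof.
move=> /bigraded_hilbertE[N hN] [N' hN'].
(* The mixed term is rewritten with [n^2 = 2 'C(n + 1, 2) - n], so [e 1 1] enters both the quadratic
   and the linear coefficient. *)
have [] := @large_quadratic_eq0 (e 2%N 0%N + e 0%N 2%N + 2 * e 1%N 1%N - eIJ 0%N)
  (eIJ 1%N - e 1%N 1%N - e 1%N 0%N - e 0%N 1%N) (e 0%N 0%N - eIJ 2%N);
  last by move=> _ _ /subr0_eq.
exists (maxn N N') => n; rewrite geq_max => /andP[Nn /hN'].
rewrite exprMn -/(bilen I J n n) (hN n n Nn Nn).
by have := bin2Z n; nra.
Qed.
End HilbertPolynomials.

(** * From the three conditions to the joint reduction lattice *)

Section Implications.
Variables (R : comNzRingType) (m I J : ideal R) (a b : R) (r0 s0 : nat).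
Hypothesis ab_joint : joint_reduction I J a b.

Let Ia : ideal_set I a. Proof. by case: ab_joint. Qed.
Let Jb : ideal_set J b. Proof. by case: ab_joint. Qed.

Lemma condition_c_a : condition_c I J a b r0 s0 -> condition_a I J a b r0 s0.
Proof.
move=> [N hN]; exists N => k /hN M10; apply: ideal_eq; last exact: M1_den_sub_num.
move=> x xI.
have : M1 I J a b r0 s0 k (\pi_(quot (M1_den I J a b r0 s0 k)) x) by exists x.
rewrite M10 => x0; suff : ideal_set (M1_den I J a b r0 s0 k) (x - 0) by rewrite subr0.
by apply/quot_eqP; rewrite (x0 : _ = 0) quot_pi0.
Qed.

Lemma condition_b_a : cohen_macaulay_local m -> krull_dim R 2 ->
  primary_to m I -> primary_to m J ->
  condition_b I J a b r0 s0 -> condition_a I J a b r0 s0.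
Proof.
move=> R_CM R_dim2 I_pr J_pr.
move=> [eI [eJ [eIJ [e [g1 [g2 [h1 [h2 [[hI hJ hIJ] [[hb hrow hcol] [b1 b2 b3]]]]]]]]]]].
have [_ _ [N red]] := ab_joint.
have [N1 big] := bigraded_hilbertE hb.
have [N2 row] := hrow r0; have [N3 col] := hcol s0.
have diff := bilen_mixed_difference R_CM R_dim2 I_pr J_pr ab_joint.
(* The successor makes [k] positive, so that [Ftilde_at] at [k] is one of the terms united in
   [Ftilde]. *)
exists (N1 + N2 + N3).+1 => k hk.
have mult_le : (len (1 : ideal R) (princ (a ^+ k) + princ (b ^+ k) : ideal R))%:Z
    <= e 1%N 1%N * (k%:Z * k%:Z).
  (* At [(n, n)] the term [M1] vanishes and the mixed difference is [k^2 e 1 1]; dropping the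
     nonnegative length of [F_k] leaves the bound. *)
  pose n := (N + N1)%N; have := diff n n k.
  rewrite (reduction_eq_pow Ia Jb k red) ?leq_addr// lenxx.
  rewrite !big; [|rewrite /n; lia..].
  rewrite !PoszD; set q := len _ _; set f := len (Ftilde_at _ _ _ _ _ _ _) _ => E.
  have f0 : 0 <= f%:Z by [].
  by lra.
have fIJ : finite_length 1 (I ^+ r0 * J ^+ s0 : ideal R).
  by apply: (finite_length_m_radical R_CM); exact: sub_radical_IJ.
have F_le : (len (Ftilde_at I J a b r0 s0 k) (I ^+ r0 * J ^+ s0)%R
             <= len (Ftilde I J a b r0 s0) (I ^+ r0 * J ^+ s0)%R)%N.
  apply: (@len_le _ _ (Ideal (is_ideal_Ftilde Ia Jb r0 s0))).
  - exact: sub_Ftilde_at.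
  - by apply: Ftilde_at_sub; lia.
  - exact: finite_lengthS fIJ.
have M10 : len (M1_num I J r0 s0 k) (M1_den I J a b r0 s0 k) = 0%N.
  (* Only the corner [(r0 + k, s0 + k)] is in the range of the bigraded polynomial; the other two
     shifted corners use row [r0] and column [s0]. The leading terms then cancel, leaving
     [l(M1) = (q - k^2 e 1 1) + (f - t)]. *)
  have := diff r0 s0 k; rewrite (big (r0 + k)%N (s0 + k)%N); [|lia..].
  rewrite (row (s0 + k)%N); last lia.
  rewrite (col (r0 + k)%N); last lia.
  rewrite -(row_hilbert_lead hb hrow) -(col_hilbert_lead hb hcol).
  rewrite (hilbert_const hb hIJ) b3 b1 b2 !PoszD.
  move: mult_le F_le; rewrite -lez_nat.
  set q := len (1 : ideal R) _; set f := len (Ftilde_at _ _ _ _ _ _ _) _.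
  set t := len (Ftilde _ _ _ _ _ _) _.
  move=> q_le f_le E; apply/eqP; rewrite -leqn0 -lez_nat; lra.
apply: ideal_eq; last exact: M1_den_sub_num.
apply: len_eq0_sub M10; first exact: M1_den_sub_num.
have := finite_length_M1_den R_CM I_pr J_pr ab_joint r0 s0 k.
exact: finite_lengthS.
Qed.

Lemma condition_a_lattice : condition_a I J a b r0 s0 ->
  for_large (fun k => joint_reduction_lattice (I ^+ k) (J ^+ k) (r0, s0)).
Proof.
(* The exponent is kept positive so that [k.+1 * r - r0] below is a genuine subtraction for
   [r >= r0]. *)
move=> [N hN]; exists N.+1 => -[//|k] /ltnW /hN eqk.
have red r s : (r0 <= r)%N -> (s0 <= s)%N ->
    reduction_eq (I ^+ k.+1) (J ^+ k.+1) (a ^+ k.+1) (b ^+ k.+1) r s.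
  move=> r0r s0s; rewrite /reduction_eq -!exprM.
  (* The equation at [(r, s)] is condition (a) multiplied by [I^r' J^s']. Large [(r, s)] give the
     joint reduction, and [(r0, s0)] gives the lattice point. *)
  pose r' := (k.+1 * r - r0)%N; pose s' := (k.+1 * s - s0)%N.
  have -> : (k.+1 * r.+1 = r' + (r0 + k.+1))%N by rewrite /r'; nia.
  have -> : (k.+1 * s.+1 = s' + (s0 + k.+1))%N by rewrite /s'; nia.
  have -> : (k.+1 * r = r' + r0)%N by rewrite /r'; nia.
  have -> : (k.+1 * s = s' + s0)%N by rewrite /s'; nia.
  rewrite ![I ^+ (r' + _)]exprD ![J ^+ (s' + _)]exprD mulrACA eqk; ring.
exists (a ^+ k.+1), (b ^+ k.+1); split; last exact: red.
split; [exact: mem_idealX|exact: mem_idealX|].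
exists (maxn r0 s0) => r s; rewrite !geq_max => /andP[r0r _] /andP[_ s0s].
exact: red.
Qed.

End Implications.

Theorem corollary3p31 (R : comNzRingType) (m I J : ideal R) (a b : R)
    (r0 s0 : nat)
    (R_CM : cohen_macaulay_local m)
    (R_dim2 : krull_dim R 2)
    (residue_infinite : infinite_set [set: quot m])
    (I_primary : primary_to m I)
    (J_primary : primary_to m J)
    (ab_joint : joint_reduction I J a b)
    (cond : [\/ condition_a I J a b r0 s0,
                condition_b I J a b r0 s0
              | condition_c I J a b r0 s0]) :
  for_large (fun k => joint_reduction_lattice (I ^+ k) (J ^+ k) (r0, s0)).
Proof.
apply: (condition_a_lattice ab_joint); case: cond => // [cb|].
  exact: condition_b_a R_CM R_dim2 I_primary J_primary cb.
exact: condition_c_a.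
Qed.
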